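(* Let $M(n)$ denote the maximum cardinality of a set $\mathsf{B}\subseteq\{0,1\}^n$ such that any two distinct strings $\mathbf{x},\mathbf{y}\in\mathsf{B}$ have a skewincidence. Then for all sufficiently large $n$, $$2^n-2^{0.96n}\le M(n)\le 2^n-2^{0.69n}.$$
   Context: Two binary strings $\mathbf{x}=x_1\dots x_n$ and $\mathbf{y}=y_1\dots y_n$ in $\{0,1\}^n$ have a skew coincidence (skewincidence) if there is a coordinate $i\in[n-1]$ with $x_i=y_{i+1}=1$ or $x_{i+1}=y_i=1$. *)

(* Defs.v *)
From mathcomp Require Import all_boot.
From Stdlib Require Import Reals.
Set Implicit Arguments. Unset Strict Implicit. Unset Printing Implicit Defensive.

(* Binary strings of length n: x_1..x_n is represented by x : 'I_n -> bool,
   with coordinate i (1-based) at index i-1 (0-based). *)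
Definition bstring (n : nat) := {ffun 'I_n -> bool}.

Definition skewinc (n : nat) (x y : bstring n) : bool :=
  [exists i : 'I_n, exists j : 'I_n,
     (val j == (val i).+1) && ((x i && y j) || (x j && y i))].

Definition skew_family (n : nat) (B : {set bstring n}) : bool :=
  [forall x in B, forall y in B, (x != y) ==> skewinc x y].

Definition M (n : nat) : nat :=
  \max_(B : {set bstring n} | skew_family B) #|B|.

(* Main.v *)
Require Import Defs.
From mathcomp Require Import all_boot zify.
From Stdlib Require Import Reals Lra.
Set Implicit Arguments. Unset Strict Implicit. Unset Printing Implicit Defensive.
Local Notation "m ^ n" := (expn m n) : nat_scope.

(** Identify strings with subsets of the path on n vertices: A and B have no
    skewincidence iff N(A) misses B, N being the neighbourhood.  So 2^n - M n
    is the vertex cover number of the graph of pairs without skewincidence.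

    Lower bound on M.  Let cl(A) be A together with the vertices all of whose
    neighbours lie in N(A); off the ends of the path, these are the middles of
    the patterns 1_0_1.  If N(A) misses B, then cl(A) misses N(B) and cl(B)
    misses N(A), so |cl(A)| + |N(A)| <= n or |cl(B)| + |N(B)| <= n.  Hence the
    sets with |cl(A)| + |N(A)| <= n form a vertex cover; summing
    (4/3)^(n - |cl(A)| - |N(A)|) with a transfer matrix shows that there are
    O((31/16)^n) of them, and (31/16)^25 < 2^24.

    Upper bound on M.  A matching of size 11^r needs only 5r + 2 coordinates:
    concatenate r blocks of length 5, each beginning with 0 so that consecutive
    blocks do not interact, after the prefix 10 on one side and 00 on the other,
    which keeps the two sides disjoint.  Finally 11^20 > 2^69. *)

(** * Skewincidence on bit words *)

(* The bits [a] and [b] precede the words [s] and [t]. *)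
Fixpoint noskew (a b : bool) (s t : seq bool) : bool :=
  match s, t with
  | x :: s', y :: t' => [&& ~~ (a && y), ~~ (x && b) & noskew x y s' t']
  | _, _ => true
  end.

Lemma noskewP (a b : bool) (s t : seq bool) :
  size s = size t ->
  reflect (forall i, i < size s ->
             ~~ (nth false (a :: s) i && nth false t i) /\
             ~~ (nth false s i && nth false (b :: t) i))
          (noskew a b s t).
Proof.
elim: s t a b => [|x s IH] [|y t] a b //=; first by move=> _; left.
move=> [size_st]; apply: (iffP and3P) => [[ay xb /IH-/(_ size_st) H] [|i] //= lti|H].
  exact: H.
have [/= ay xb] := H 0 isT; split=> //.
by apply/IH => // i lti; apply: (H i.+1).
Qed.

Definition word (n : nat) (x : bstring n) : seq bool := codom x.

Definition of_word (n : nat) (s : seq bool) : bstring n :=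
  [ffun i : 'I_n => nth false s i].

Lemma size_word (n : nat) (x : bstring n) : size (word x) = n.
Proof. by rewrite size_codom card_ord. Qed.

Lemma nth_word (n : nat) (x : bstring n) (i : 'I_n) : nth false (word x) i = x i.
Proof. by rewrite /word codomE (nth_map i) ?size_enum_ord // nth_ord_enum. Qed.

Lemma of_wordK (n : nat) (s : seq bool) : size s = n -> word (of_word n s) = s.
Proof.
move=> size_s; apply: (@eq_from_nth _ false) => [|i]; rewrite size_word // => ltin.
by rewrite (nth_word (of_word n s) (Ordinal ltin)) ffunE.
Qed.

Lemma skewinc_word (n : nat) (x y : bstring n) :
  skewinc x y = ~~ noskew false false (word x) (word y).
Proof.
have size_xy : size (word x) = size (word y) by rewrite !size_word.
apply/idP/idP => [/existsP[i /existsP[j /andP[/eqP ji xy]]]|].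
  apply/negP => /noskewP-/(_ size_xy j); rewrite size_word ltn_ord => /(_ isT).
  rewrite !nth_word -/(val j) ji /= !nth_word => -[/negbTE Hxy /negbTE Hyx].
  by move: xy; rewrite Hxy Hyx.
apply: contraR => /existsPn noxy; apply/noskewP => // -[|i]; rewrite size_word => lti /=.
  by rewrite andbF.
have lti' := ltnW lti.
have /existsPn/(_ (Ordinal lti)) := noxy (Ordinal lti').
rewrite eqxx /= negb_or -!nth_word /=.
by move=> /andP[].
Qed.

(** * Upper bound: matchings of pairs without skewincidence *)

(** A skew family misses an endpoint of each pair [(e1 w, e2 w)]; the pairs share no endpoints, so
    these misses are distinct. *)
Lemma M_le_matching (n : nat) (T : finType) (e1 e2 : T -> bstring n) :
  injective e1 -> injective e2 -> (forall u v, e1 u != e2 v) ->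
  (forall w, ~~ skewinc (e1 w) (e2 w)) ->
  M n + #|T| <= 2 ^ n.
Proof.
move=> inj1 inj2 disj noskew_e.
have [|B skewB maxB] := @eq_bigmax_cond _ (@skew_family n) (fun B => #|B|).
  by apply/card_gt0P; exists set0; apply/'forall_implyP => x; rewrite inE.
rewrite [M n]maxB; have -> : 2 ^ n = #|B| + #|~: B| by rewrite cardsC card_ffun card_bool card_ord.
rewrite leq_add2l.
pose f w := if e1 w \in B then e2 w else e1 w.
have inj_f : injective f.
  move=> u v; rewrite /f; do 2![case: ifP => _].
  - exact: inj2.
  - by move/eqP; rewrite eq_sym (negbTE (disj _ _)).
  - by move/eqP; rewrite (negbTE (disj _ _)).
  - exact: inj1.
have fNB w : f w \notin B.
  rewrite /f; case: ifP => [in1|->//]; apply/negP => in2.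
  have /'forall_implyP/(_ _ in1)/'forall_implyP/(_ _ in2) := skewB.
  by rewrite disj (negbTE (noskew_e w)).
rewrite -cardsT -(card_imset _ inj_f).
by apply/subset_leq_card/subsetP => _ /imsetP[w _ ->]; rewrite inE.
Qed.

(** An involution on 11 words: three swaps, and five fixed words without adjacent ones. *)
Definition matched_blocks : seq (seq bool * seq bool) :=
  let o := false in let i := true in
  [:: ([:: o; o; o; o; o], [:: o; o; o; i; i]); ([:: o; o; o; i; i], [:: o; o; o; o; o]);
      ([:: o; o; o; o; i], [:: o; i; i; o; o]); ([:: o; i; i; o; o], [:: o; o; o; o; i]);
      ([:: o; i; o; o; o], [:: o; i; o; i; i]); ([:: o; i; o; i; i], [:: o; i; o; o; o]);
      ([:: o; o; o; i; o], [:: o; o; o; i; o]); ([:: o; o; i; o; o], [:: o; o; i; o; o]);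
      ([:: o; o; i; o; i], [:: o; o; i; o; i]); ([:: o; i; o; o; i], [:: o; i; o; o; i]);
      ([:: o; i; o; i; o], [:: o; i; o; i; o])].

Definition block1 (k : 'I_11) : seq bool := (nth ([::], [::]) matched_blocks k).1.
Definition block2 (k : 'I_11) : seq bool := (nth ([::], [::]) matched_blocks k).2.


Lemma noskew_blocks (w : seq 'I_11) (m : nat) (a b : bool) :
  noskew a b (flatten (map block1 w) ++ nseq m false)
             (flatten (map block2 w) ++ nseq m false).
Proof.
elim: w a b => [|k w IH] a b.
  by elim: m a b => //= m IH a b; rewrite andbF IH.
by case: k; do 11?[case; first by move=> ?; rewrite /= !andbF IH].
Qed.

Lemma flatten_map_inj (T : Type) (S : eqType) (f : T -> seq S) (l : nat) (s : seq S)
    (w w' : seq T) :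
  injective f -> (forall k, size (f k) = l) -> size w = size w' ->
  flatten (map f w) ++ s = flatten (map f w') ++ s -> w = w'.
Proof.
move=> inj_f size_f; elim: w w' => [|k w IH] [|k' w'] //= [size_w] /eqP.
rewrite -!catA eqseq_cat ?size_f // => /andP[/eqP/inj_f -> /eqP/(IH _ size_w)->].
by [].
Qed.

Lemma size_block1 k : size (block1 k) = 5.
Proof. by case: k; do 11?[case=> //]. Qed.

Lemma size_block2 k : size (block2 k) = 5.
Proof. by case: k; do 11?[case=> //]. Qed.

Lemma block1_inj : injective block1.
Proof.
move=> j k /eqP; rewrite /block1 -!(nth_map _ [::]) ?ltn_ord //.
by rewrite nth_uniq ?ltn_ord // => /eqP/val_inj.
Qed.

Lemma block2_inj : injective block2.
Proof.
move=> j k /eqP; rewrite /block2 -!(nth_map _ [::]) ?ltn_ord //.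
by rewrite nth_uniq ?ltn_ord // => /eqP/val_inj.
Qed.

Lemma M_le_pow11 (n r : nat) : 5 * r + 2 <= n -> M n + 11 ^ r <= 2 ^ n.
Proof.
move=> le_rn; pose m := n - (5 * r + 2).
pose enc b f (w : r.-tuple 'I_11) :=
  [:: b, false & flatten (map f w) ++ nseq m false].
have size_enc b f w : (forall k, size (f k) = 5) -> size (enc b f w) = n.
  move=> size_f; rewrite /= size_cat size_nseq size_flatten /shape -map_comp.
  rewrite (@eq_map _ _ _ (fun=> 5) size_f).
  rewrite sumnE big_map big_const_seq count_predT size_tuple iter_addn_0 /m.
  lia.
have enc_inj b f : injective f -> (forall k, size (f k) = 5) ->
    injective (fun w => of_word n (enc b f w)).
  move=> inj_f size_f u v /(congr1 (@word n)); rewrite !of_wordK ?size_enc //.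
  move=> [] /(flatten_map_inj inj_f size_f) uv.
  by apply/val_inj/uv; rewrite !size_tuple.
have -> : 11 ^ r = #|{: r.-tuple 'I_11}| by rewrite card_tuple card_ord.
apply: (@M_le_matching _ _ (fun w => of_word n (enc true block1 w))
                           (fun w => of_word n (enc false block2 w))).
- exact: (enc_inj _ _ block1_inj size_block1).
- exact: (enc_inj _ _ block2_inj size_block2).
- move=> u v; apply/eqP => /(congr1 (@word n)).
  by rewrite !of_wordK ?size_enc //; [exact: size_block2 | exact: size_block1].
- move=> w; rewrite skewinc_word negbK !of_wordK ?size_enc //=.
  + exact: noskew_blocks.
  + exact: size_block2.
  + exact: size_block1.
Qed.

(** * Lower bound: window weights and a transfer matrix *)

(* In the window (a, b, c, d, e) centred at c, the two disjunctions say that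
   the centre lies in cl and in N.  A window meeting k of them has weight
   48 * (4/3)^(1 - k), an integer for k = 0, 1, 2. *)
Definition window_weight (a b c d e : bool) : nat :=
  nth 36 [:: 64; 48] ((c || a && e) + (b || d)).

Fixpoint weight (a b c d : bool) (s : seq bool) : nat :=
  if s is e :: s' then window_weight a b c d e * weight b c d e s' else 1.

Lemma weight_noskew (u v a b c d a' b' c' d' : bool) (s t : seq bool) :
  size s = size t ->
  noskew u v [:: a, b, c, d & s] [:: a', b', c', d' & t] ->
  48 ^ size s * 48 ^ size s <= weight a b c d s * weight a' b' c' d' t.
Proof.
elim: s t u v a b c d a' b' c' d' => [|e s IH] [|e' t] // u v a b c d a' b' c' d'.
move=> [size_st] /and3P[_ _ noskew_st]; have {}IH := IH _ _ _ _ _ _ _ _ _ _ _ size_st noskew_st.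
have window : 48 * 48 <= window_weight a b c d e * window_weight a' b' c' d' e'.
  (* The centre cannot lie in cl of one set and in N of the other, so each of these two crossed
     pairs contributes at most 1. *)
  have : (c || a && e) + (b || d) + ((c' || a' && e') + (b' || d')) <= 2.
    move: noskew_st => {IH} /=.
    by case: a; case: a' => //=; case: b; case: b' => //=; case: c; case: c' => //=;
       case: d; case: d' => //=; case: e; case: e'.
  rewrite /window_weight.
  by case: (c || _); case: (b || _); case: (c' || _); case: (b' || _) => //= _; lia.
by rewrite /= !expnS mulnACA [leqRHS]mulnACA leq_mul.
Qed.

(* [potential] is a supersolution, for the eigenvalue 93, of the transfer matrix
   of [window_weight]; the even and odd positions interact only through the
   first factor, which anticipates the N-part of the next window. *)
Definition potential2 (p q : bool) : nat := if q then 9 else if p then 14 else 15.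

Definition potential (a b c d : bool) : nat :=
  (if b || d then 3 else 4) * (potential2 a c * potential2 b d).

(** Induction on the first bit; 93 = 48 * 31/16 is the growth rate 31/16 scaled by the 48 of each
    window. *)
Lemma sum_weight (n : nat) (a b c d : bool) :
  \sum_(s : n.-tuple bool) weight a b c d s <= 93 ^ n * potential a b c d.
Proof.
elim: n a b c d => [|n IH] a b c d.
  rewrite (eq_bigr (fun=> 1)) => [|s _]; last by rewrite (tuple0 s).
  rewrite sum1_card card_tuple.
  by case: a; case: b; case: c; case: d.
rewrite (reindex (fun p : bool * n.-tuple bool => cons_tuple p.1 p.2)) /=; last first.
  exists (fun s => (thead s, behead_tuple s)) => [[e s] _|s _] /=.
    by congr pair; apply/val_inj.
  by rewrite [RHS]tuple_eta; apply/val_inj.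
rewrite -(pair_bigA _ (fun e (s : n.-tuple bool) =>
  window_weight a b c d e * weight b c d e s)) big_bool /= -!big_distrr /=.
apply: leq_trans (leq_add (leq_mul (leqnn _) (IH b c d true))
                          (leq_mul (leqnn _) (IH b c d false))) _.
rewrite expnSr -mulnA !(mulnCA _ (93 ^ n)) -mulnDr leq_mul2l.
apply/orP; right; rewrite /window_weight /potential /potential2.
(* The supersolution inequality, one case per state. *)
by case: a; case: b; case: c; case: d => /=; lia.
Qed.

(** With four zeros in front, the n windows are centred at coordinates -1 to n - 2; [weight_noskew]
    compares them one by one, so this shift is harmless. *)
Lemma skew_family_weight (n : nat) :
  skew_family [set x : bstring n | weight false false false false (word x) < 48 ^ n].
Proof.
apply/'forall_implyP => x; rewrite inE => ltx.
apply/'forall_implyP => y; rewrite inE => lty; apply/implyP => _.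
rewrite skewinc_word; apply/negP => noskew_xy.
have size_xy : size (word x) = size (word y) by rewrite !size_word.
have := @weight_noskew false false false false false false false false false false _ _ size_xy noskew_xy.
by rewrite size_word leqNgt ltn_mul.
Qed.

(** Markov's inequality for the strings of weight at least [48 ^ n]; 900 is [potential] at the zero
    state. *)
Lemma M_ge_weight (n : nat) : 2 ^ n * 48 ^ n <= M n * 48 ^ n + 900 * 93 ^ n.
Proof.
pose B := [set x : bstring n | weight false false false false (word x) < 48 ^ n].
have leBM : #|B| <= M n by apply: leq_bigmax_cond (skew_family_weight n).
have card_C : #|~: B| * 48 ^ n <= 93 ^ n * 900.
  apply: leq_trans _ (sum_weight n false false false false).
  apply: (@leq_trans (\sum_(x : bstring n) weight false false false false (word x))).
    rewrite -sum_nat_const [leqRHS](bigID [in ~: B]) /=.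
    apply: leq_trans (leq_addr _ _).
    by apply: leq_sum => x; rewrite !inE -leqNgt.
  rewrite (reindex (fun s : n.-tuple bool => of_word n s)) /=.
    by apply: leq_sum => s _; rewrite of_wordK ?size_tuple.
  exists (fun x => Tuple (introT eqP (size_word x))) => [s _|x _].
    by apply/val_inj; rewrite /= of_wordK ?size_tuple.
  by apply/ffunP => i; rewrite ffunE nth_word.
have -> : 2 ^ n = #|B| + #|~: B| by rewrite cardsC card_ffun card_bool card_ord.
rewrite mulnDl leq_add ?leq_mul2r ?leBM ?orbT // mulnC.
by rewrite mulnC (mulnC 900).
Qed.

(** * Passage to real exponents *)

Lemma INR_expn (m n : nat) : INR (m ^ n) = (INR m ^ n)%R.
Proof. by elim: n => // n IH; rewrite expnS mult_INR IH. Qed.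

Lemma eventually_le_linear (c delta : R) : (0 < delta)%R ->
  exists N : nat, forall n : nat, (N <= n)%coq_nat -> (c <= INR n * delta)%R.
Proof.
move=> delta0; have [N cN] := INR_unbounded (c / delta).
exists N => n /le_INR leNn.
have : (c / delta * delta <= INR n * delta)%R by apply: Rmult_le_compat_r; lra.
by rewrite /Rdiv Rmult_assoc Rinv_l; lra.
Qed.

Lemma pow_expln (x : R) (n : nat) : (0 < x)%R -> (x ^ n = exp (INR n * ln x))%R.
Proof. by move=> x0; rewrite -(exp_ln (x ^ n)) ?ln_pow //; apply: pow_lt. Qed.

Lemma exp_le (x y : R) : (x <= y)%R -> (exp x <= exp y)%R.
Proof. by case=> [/exp_increasing/Rlt_le|->]; last exact: Rle_refl. Qed.

Lemma ln_lower_rate : (0 < 96 / 100 * ln 2 + ln 48 - ln 93)%R.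
Proof.
(* This is (31/16)^25 < 2^24, and 24/25 = 0.96. *)
have : (ln (93 ^ 25) < ln (48 ^ 25 * 2 ^ 24))%R by apply: ln_increasing; lra.
rewrite ln_mult ?ln_pow; try lra.
by rewrite !INR_IZR_INZ /=; lra.
Qed.

Lemma ln_upper_rate : (0 < ln 11 / 5 - 69 / 100 * ln 2)%R.
Proof.
(* Taking hundredth roots gives 2^0.69 < 11^(1/5). *)
have : (ln (2 ^ 69) < ln (11 ^ 20))%R by apply: ln_increasing; lra.
rewrite !ln_pow; try lra.
by rewrite !INR_IZR_INZ /=; lra.
Qed.

Lemma M_ge_eventually :
  exists N : nat, forall n : nat, (N <= n)%coq_nat ->
    (2 ^ n - Rpower 2 (96 / 100 * INR n) <= INR (M n))%R.
Proof.
have [N leN] := eventually_le_linear (ln 900) ln_lower_rate.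
exists N => n /leN len.
have /leP/le_INR := M_ge_weight n.
rewrite plus_INR !mult_INR !INR_expn ![INR _.+1]INR_IZR_INZ /= => le_M.
have pow48 : (0 < 48 ^ n)%R by apply: pow_lt; lra.
have : (900 * 93 ^ n <= Rpower 2 (96 / 100 * INR n) * 48 ^ n)%R.
  rewrite -{1}(exp_ln 900) /Rpower ?pow_expln; try lra.
  by rewrite -!exp_plus; apply: exp_le; lra.
by move=> le_exp; apply: (Rmult_le_reg_r (48 ^ n)); lra.
Qed.

Lemma M_le_eventually :
  exists N : nat, forall n : nat, (N <= n)%coq_nat ->
    (INR (M n) <= 2 ^ n - Rpower 2 (69 / 100 * INR n))%R.
Proof.
(* Since [r] is at least (n - 6)/5, rounding costs at most a factor 11^(6/5), which the linear slack
   absorbs. *)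
have [N leN] := eventually_le_linear (6 / 5 * ln 11) ln_upper_rate.
exists (N + 2) => n le_n.
have {}leN : (6 / 5 * ln 11 <= INR n * (ln 11 / 5 - 69 / 100 * ln 2))%R.
  by apply: leN; lia.
pose r := (n - 2) %/ 5.
have [le_rn lt_nr] : 5 * r + 2 <= n /\ n <= 5 * r + 6 by rewrite /r; lia.
have /leP/le_INR := M_le_pow11 le_rn.
rewrite plus_INR !INR_expn ![INR _.+1]INR_IZR_INZ /= => le_M.
have : (Rpower 2 (69 / 100 * INR n) <= 11 ^ r)%R.
  have ln11 : (0 < ln 11)%R by rewrite -ln_1; apply: ln_increasing; lra.
  have /leP/le_INR := lt_nr.
  rewrite plus_INR mult_INR ![INR _.+1]INR_IZR_INZ /= => lt_nr'.
  rewrite /Rpower pow_expln; last lra.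
  by apply: exp_le; nra.
by move=> ?; lra.
Qed.

Theorem theorem1 :
  exists N : nat, forall n : nat, (N <= n)%coq_nat ->
    (2 ^ n - Rpower 2 (96 / 100 * INR n) <= INR (M n))%R /\
    (INR (M n) <= 2 ^ n - Rpower 2 (69 / 100 * INR n))%R.
Proof.
have [N1 ge_M] := M_ge_eventually; have [N2 le_M] := M_le_eventually.
exists (N1 + N2) => n le_n; split; [apply: ge_M | apply: le_M]; lia.
Qed.
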